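(* Let $Q$ be a finite $3$-divisible Moufang loop. Then $Q$ is classically solvable if and only if it is congruence solvable.
   Context: A loop is an algebra $(Q,\cdot,\backslash,/,1)$ satisfying $x\backslash(x\cdot y)=x\cdot(x\backslash y)=y=(y\cdot x)/x=(y/x)\cdot x$ and $x\cdot 1=x=1\cdot x$. A Moufang loop is a loop satisfying $x(y(xz))=((xy)x)z$ for all $x,y,z$; any two elements of a Moufang loop generate a group, so powers are well defined. A Moufang loop $Q$ is $3$-divisible if the map $x\mapsto x^3$ is onto $Q$. For $u\in Q$ let $L_u(v)=uv$, $R_u(v)=vu$, and $\mathrm{Mlt}(Q)=\langle L_u,R_u:u\in Q\rangle$. An inner mapping of $Q$ is an element of $\mathrm{Mlt}(Q)$ that fixes $1$. A subloop $X$ of $Q$ is normal, written $X\unlhd Q$, if it is invariant under all inner mappings of $Q$ (equivalently, $X$ is the class containing $1$ of some congruence of $Q$). A normal subloop $X$ of a loop $Q$ induces the congruence $\alpha_X$ of $Q$ given by $u\,\alpha_X\,v$ iff $uX=vX$. A congruence $\alpha$ of $Q$ is abelian if for every $n\ge 0$, every $(n+1)$-ary term operation $t$ in the signature $(\cdot,\backslash,/,1)$ and all $a,b,u_1,v_1,\dots,u_n,v_n\in Q$ with $a\,\alpha\,b$ and $u_i\,\alpha\,v_i$ for all $i$: if $t(a,u_1,\dots,u_n)=t(a,v_1,\dots,v_n)$ then $t(b,u_1,\dots,u_n)=t(b,v_1,\dots,v_n)$. ''$X$ induces an abelian congruence of $Q$'' means that $\alpha_X$ is abelian. A loop $Q$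 is classically solvable if there is a series $Q=Q_0\ge Q_1\ge\cdots\ge Q_n=1$ of subloops such that $Q_{i+1}\unlhd Q_i$ and $Q_i/Q_{i+1}$ is a commutative group for every $i$. (An equivalent definition requires $Q_{i+1}\unlhd Q$ instead of $Q_{i+1}\unlhd Q_i$.) A loop $Q$ is congruence solvable if there is a series $Q=Q_0\ge Q_1\ge\cdots\ge Q_n=1$ of subloops such that, for every $i$, $Q_{i+1}\unlhd Q$ and the normal subloop $Q_i/Q_{i+1}$ of $Q/Q_{i+1}$ induces an abelian congruence of $Q/Q_{i+1}$. *)

(* Defs.v *)
From HB Require Import structures.
From mathcomp Require Import all_boot all_fingroup.
From mathcomp Require Import generic_quotient.

Set Implicit Arguments.
Unset Strict Implicit.
Unset Printing Implicit Defensive.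

Local Open Scope quotient_scope.

(* [ldiv x y] is x \ y and [rdiv x y] is x / y. *)
HB.mixin Record isLoop Q := {
  lmul : Q -> Q -> Q;
  ldiv : Q -> Q -> Q;
  rdiv : Q -> Q -> Q;
  lone : Q;
  ldivK : forall x y : Q, ldiv x (lmul x y) = y;
  lmulK : forall x y : Q, lmul x (ldiv x y) = y;
  rmulK : forall x y : Q, rdiv (lmul y x) x = y;
  rdivK : forall x y : Q, lmul (rdiv y x) x = y;
  lmulx1 : right_id lone lmul;
  lmul1x : left_id lone lmul
}.

#[short(type="loopType")]
HB.structure Definition Loop := {Q of isLoop Q}.

#[short(type="finLoopType")]
HB.structure Definition FinLoop := {Q of Finite Q & Loop Q}.

Declare Scope loop_scope.
Delimit Scope loop_scope with L.
Notation "x * y" := (lmul x y) : loop_scope.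
Notation "1" := (@lone _) : loop_scope.
Local Open Scope loop_scope.

Definition moufang (Q : loopType) :=
  forall x y z : Q, x * (y * (x * z)) = ((x * y) * x) * z.

Definition three_divisible (Q : loopType) := forall y : Q, exists x : Q, x * (x * x) = y.

(* An associative loop is a group. *)
Definition commutative_group (Q : loopType) :=
  associative (@lmul Q) /\ commutative (@lmul Q).

Section AbelianCongruences.

Inductive loop_term (n : nat) : Type :=
| TVar of 'I_n
| TOne
| TMul of loop_term n & loop_term n
| TLdiv of loop_term n & loop_term n
| TRdiv of loop_term n & loop_term n.

Fixpoint term_op (Q : loopType) n (t : loop_term n) (e : 'I_n -> Q) : Q :=
  match t with
  | TVar i => e i
  | TOne => 1
  | TMul t1 t2 => term_op t1 e * term_op t2 e
  | TLdiv t1 t2 => ldiv (term_op t1 e) (term_op t2 e)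
  | TRdiv t1 t2 => rdiv (term_op t1 e) (term_op t2 e)
  end.

(* The (n+1)-tuple (a, u_0, ..., u_(n-1)). *)
Definition env_cons (T : Type) n (a : T) (u : 'I_n -> T) : 'I_n.+1 -> T :=
  fun i => oapp u a (unlift ord0 i).

Definition abelian_congruence (Q : loopType) (alpha : rel Q) :=
  forall n (t : loop_term n.+1) (a b : Q) (u v : 'I_n -> Q),
    alpha a b -> (forall i, alpha (u i) (v i)) ->
    term_op t (env_cons a u) = term_op t (env_cons a v) ->
    term_op t (env_cons b u) = term_op t (env_cons b v).

End AbelianCongruences.

Section Translations.

Variable Q : finLoopType.

Lemma ltrans_inj (u : Q) : injective (lmul u).
Proof. exact: can_inj (ldivK u). Qed.

Lemma rtrans_inj (u : Q) : injective (fun v : Q => v * u).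
Proof. exact: (can_inj (g := fun v => rdiv v u) (rmulK u)). Qed.

Definition ltrans (u : Q) : {perm Q} := perm (@ltrans_inj u).
Definition rtrans (u : Q) : {perm Q} := perm (@rtrans_inj u).

Definition Mlt : {set {perm Q}} :=
  <<[set ltrans u | u in Q] :|: [set rtrans u | u in Q]>>%g.
Canonical Mlt_group := [group of Mlt].

Definition Inn : {set {perm Q}} := ('C_Mlt[(1 : Q)%L | 'P])%g.

End Translations.

Arguments Mlt : clear implicits.
Arguments Inn : clear implicits.

Record subloop (Q : finLoopType) := Subloop {
  subloop_set :> {set Q};
  subloop1 : 1 \in subloop_set;
  subloopM : {in subloop_set &, forall x y, x * y \in subloop_set};
  subloopL : {in subloop_set &, forall x y, ldiv x y \in subloop_set};
  subloopR : {in subloop_set &, forall x y, rdiv x y \in subloop_set}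
}.

Definition normal_subloop (Q : finLoopType) (X : subloop Q) : bool :=
  [acts Inn Q, on X | 'P]%g.

Definition subloop_sort (Q : finLoopType) (X : subloop Q) : Type :=
  {x : Q | x \in subloop_set X}.

Section SubloopLoop.

Variables (Q : finLoopType) (X : subloop Q).

HB.instance Definition _ := SubFinite.copy (subloop_sort X) {x : Q | x \in subloop_set X}.

Implicit Types x y : subloop_sort X.

Definition sub_one : subloop_sort X := exist _ 1 (subloop1 X).
Definition sub_mul x y : subloop_sort X :=
  exist _ (val x * val y) (subloopM (valP x) (valP y)).
Definition sub_ldiv x y : subloop_sort X :=
  exist _ (ldiv (val x) (val y)) (subloopL (valP x) (valP y)).
Definition sub_rdiv x y : subloop_sort X :=
  exist _ (rdiv (val x) (val y)) (subloopR (valP x) (valP y)).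

Lemma sub_mul1x : left_id sub_one sub_mul.
Proof. by move=> x; apply: val_inj; rewrite /= lmul1x. Qed.
Lemma sub_mulx1 : right_id sub_one sub_mul.
Proof. by move=> x; apply: val_inj; rewrite /= lmulx1. Qed.
Lemma sub_ldivK x y : sub_ldiv x (sub_mul x y) = y.
Proof. by apply: val_inj; rewrite /= ldivK. Qed.
Lemma sub_lmulK x y : sub_mul x (sub_ldiv x y) = y.
Proof. by apply: val_inj; rewrite /= lmulK. Qed.
Lemma sub_rmulK x y : sub_rdiv (sub_mul y x) x = y.
Proof. by apply: val_inj; rewrite /= rmulK. Qed.
Lemma sub_rdivK x y : sub_mul (sub_rdiv y x) x = y.
Proof. by apply: val_inj; rewrite /= rdivK. Qed.

HB.instance Definition _ := isLoop.Build (subloop_sort X)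
  sub_ldivK sub_lmulK sub_rmulK sub_rdivK sub_mulx1 sub_mul1x.

End SubloopLoop.

(* The intersection of Y with X, seen as a subloop of the loop X. *)
Section RestrictedSubloop.

Variables (Q : finLoopType) (X Y : subloop Q).

Definition restrict_set : {set subloop_sort X} := [set x | val x \in subloop_set Y].

Lemma restrict1 : 1 \in restrict_set.
Proof. by rewrite inE subloop1. Qed.
Lemma restrictM : {in restrict_set &, forall x y, x * y \in restrict_set}.
Proof. by move=> x y; rewrite !inE; apply: subloopM. Qed.
Lemma restrictL : {in restrict_set &, forall x y, ldiv x y \in restrict_set}.
Proof. by move=> x y; rewrite !inE; apply: subloopL. Qed.
Lemma restrictR : {in restrict_set &, forall x y, rdiv x y \in restrict_set}.
Proof. by move=> x y; rewrite !inE; apply: subloopR. Qed.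

Definition restrict : subloop (subloop_sort X) :=
  Subloop restrict1 restrictM restrictL restrictR.

End RestrictedSubloop.

Section Cosets.

Variables (Q : finLoopType) (X : {set Q}).

Definition loop_coset (u : Q) : {set Q} := [set u * x | x in X].

Definition coset_rel : rel Q := fun u v => loop_coset u == loop_coset v.

Lemma coset_rel_refl : reflexive coset_rel. Proof. by move=> u; apply: eqxx. Qed.
Lemma coset_rel_sym : symmetric coset_rel. Proof. by move=> u v; apply: eq_sym. Qed.
Lemma coset_rel_trans : transitive coset_rel.
Proof. by rewrite /coset_rel => v u w /eqP->. Qed.

Canonical coset_equiv := EquivRel coset_rel coset_rel_refl coset_rel_sym coset_rel_trans.

Definition induces_abelian_congruence := abelian_congruence coset_rel.

End Cosets.

Section CosetCongruence.

Variables (Q : finLoopType) (X : subloop Q).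
Hypothesis nX : normal_subloop X.

Local Notation "u ~ v" := (coset_rel X u v) (at level 70).

Lemma ltrans_Mlt (u : Q) : ltrans u \in Mlt Q.
Proof. by apply: mem_gen; rewrite inE imset_f. Qed.

Lemma rtrans_Mlt (u : Q) : rtrans u \in Mlt Q.
Proof. by apply: mem_gen; rewrite inE orbC imset_f. Qed.

Lemma normal_inn f x : f \in Mlt Q -> f 1 = 1 -> x \in subloop_set X -> f x \in subloop_set X.
Proof.
move=> Mf f1 Xx; have /(actsP nX)/(_ x) : f \in Inn Q; last by rewrite Xx.
by rewrite inE Mf; apply/astab1P.
Qed.

Lemma Mlt_coset f u : f \in Mlt Q -> f @: loop_coset X u = loop_coset X (f u).
Proof.
move=> Mf; apply/eqP; rewrite eqEcard; apply/andP; split; last first.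
  rewrite [leqRHS]card_imset ?perm_inj //; last exact: perm_inj.
  by rewrite !card_imset //; apply: ltrans_inj.
apply/subsetP=> _ /imsetP[_ /imsetP[x Xx ->] ->].
pose g := (ltrans u * f * (ltrans (f u))^-1)%g.
have Lg y : f u * g y = f (u * y).
  by rewrite /g !permM [ltrans u y]permE -{1}[f u * _](permE (@ltrans_inj _ (f u))) permKV.
rewrite -Lg imset_f //; apply: normal_inn Xx.
  by rewrite !groupM ?groupV ?ltrans_Mlt.
by apply: (@ltrans_inj _ (f u)); rewrite Lg !lmulx1.
Qed.

Lemma Mlt_coset_rel f u v : f \in Mlt Q -> (f u ~ f v) = (u ~ v).
Proof.
move=> Mf; rewrite /coset_rel -!Mlt_coset //.
by apply/eqP/eqP=> [|->//]; apply: imset_inj; apply: perm_inj.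
Qed.

Lemma coset_rel_mul2l w u v : (w * u ~ w * v) = (u ~ v).
Proof. by have := Mlt_coset_rel u v (ltrans_Mlt w); rewrite !permE. Qed.

Lemma coset_rel_mul2r w u v : (u * w ~ v * w) = (u ~ v).
Proof. by have := Mlt_coset_rel u v (rtrans_Mlt w); rewrite !permE. Qed.

Lemma coset_relM u u' v v' : u ~ u' -> v ~ v' -> u * v ~ u' * v'.
Proof.
move=> uu' vv'; apply: (@coset_rel_trans _ _ (u' * v)).
  by rewrite coset_rel_mul2r.
by rewrite coset_rel_mul2l.
Qed.

Lemma coset_relL u u' v v' : u ~ u' -> v ~ v' -> ldiv u v ~ ldiv u' v'.
Proof.
move=> uu' vv'; rewrite -(coset_rel_mul2l u') lmulK.
apply: coset_rel_trans vv'; rewrite -{2}[v](lmulK u).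
by rewrite coset_rel_mul2r coset_rel_sym.
Qed.

Lemma coset_relR u u' v v' : u ~ u' -> v ~ v' -> rdiv u v ~ rdiv u' v'.
Proof.
move=> uu' vv'; rewrite -(coset_rel_mul2r v') rdivK.
apply: coset_rel_trans uu'; rewrite -{2}[u](rdivK v).
by rewrite coset_rel_mul2l coset_rel_sym.
Qed.

End CosetCongruence.

Definition quotient_loop (Q : finLoopType) (X : subloop Q) (nX : normal_subloop X) : Type :=
  {eq_quot coset_equiv X}.

Section QuotientLoop.

Variables (Q : finLoopType) (X : subloop Q) (nX : normal_subloop X).
Local Notation QX := (quotient_loop nX).

HB.instance Definition _ := Quotient.copy QX {eq_quot coset_equiv X}.
HB.instance Definition _ := [Finite of QX by <:%/].

Definition quot_mul (x y : QX) : QX := \pi_QX (repr x * repr y).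
Definition quot_ldiv (x y : QX) : QX := \pi_QX (ldiv (repr x) (repr y)).
Definition quot_rdiv (x y : QX) : QX := \pi_QX (rdiv (repr x) (repr y)).

Lemma repr_coset_rel (u : Q) : coset_rel X (repr (\pi_QX u)) u.
Proof. by apply/eqquotP; apply: (reprK (\pi_QX u)). Qed.

Lemma pi_mul u v : quot_mul (\pi_QX u) (\pi_QX v) = \pi_QX (u * v).
Proof. by apply/eqquotP/coset_relM => //; apply: repr_coset_rel. Qed.
Lemma pi_ldiv u v : quot_ldiv (\pi_QX u) (\pi_QX v) = \pi_QX (ldiv u v).
Proof. by apply/eqquotP/coset_relL => //; apply: repr_coset_rel. Qed.
Lemma pi_rdiv u v : quot_rdiv (\pi_QX u) (\pi_QX v) = \pi_QX (rdiv u v).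
Proof. by apply/eqquotP/coset_relR => //; apply: repr_coset_rel. Qed.

Lemma quot_mul1x : left_id (\pi_QX 1) quot_mul.
Proof. by elim/quotW=> u; rewrite pi_mul lmul1x. Qed.
Lemma quot_mulx1 : right_id (\pi_QX 1) quot_mul.
Proof. by elim/quotW=> u; rewrite pi_mul lmulx1. Qed.
Lemma quot_ldivK x y : quot_ldiv x (quot_mul x y) = y.
Proof. by elim/quotW: x => u; elim/quotW: y => v; rewrite pi_mul pi_ldiv ldivK. Qed.
Lemma quot_lmulK x y : quot_mul x (quot_ldiv x y) = y.
Proof. by elim/quotW: x => u; elim/quotW: y => v; rewrite pi_ldiv pi_mul lmulK. Qed.
Lemma quot_rmulK x y : quot_rdiv (quot_mul y x) x = y.
Proof. by elim/quotW: x => u; elim/quotW: y => v; rewrite pi_mul pi_rdiv rmulK. Qed.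
Lemma quot_rdivK x y : quot_mul (quot_rdiv y x) x = y.
Proof. by elim/quotW: x => u; elim/quotW: y => v; rewrite pi_rdiv pi_mul rdivK. Qed.

HB.instance Definition _ := isLoop.Build QX
  quot_ldivK quot_lmulK quot_rmulK quot_rdivK quot_mulx1 quot_mul1x.

(* Y / X as a subset of Q / X. *)
Definition quotient_set (Y : {set Q}) : {set QX} := [set \pi_QX y | y in Y].

End QuotientLoop.

Definition classically_solvable (Q : finLoopType) : Prop :=
  exists (n : nat) (S : nat -> subloop Q),
    [/\ S 0 = [set: Q] :> {set Q}, S n = [set 1] :> {set Q} &
      forall i, i < n ->
        S i.+1 \subset S i /\
        exists nS : normal_subloop (restrict (S i) (S i.+1)),
          commutative_group (quotient_loop nS)].

Definition congruence_solvable (Q : finLoopType) : Prop :=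
  exists (n : nat) (S : nat -> subloop Q),
    [/\ S 0 = [set: Q] :> {set Q}, S n = [set 1] :> {set Q} &
      forall i, i < n ->
        S i.+1 \subset S i /\
        exists nS : normal_subloop (S i.+1),
          induces_abelian_congruence (quotient_set nS (S i))].

(* Main.v *)
(* Write L_x, R_x for the translations and, for a subloop X, M(X) for the
   permutation group of Q generated by L_x, R_x with x in X.

   If c(xy) = a(x)g(y) is an autotopism then g(1) satisfies R_g(1) = a^-1 c.
   Every g in the derived group Mlt(Q)^(n) extends to an autotopism whose
   other components also lie in Mlt(Q)^(n), so R_y lies in Mlt(Q)^(n) for all y
   in the orbit S_n of 1. The orbits S_n are normal, and as Mlt(Q)^(n) acts as an
   abelian group modulo S_(n+1), the subloop S_n is modulo S_(n+1) commutative
   and satisfies (ux)y = u(xy) for u in Q and x, y in S_n. In a Moufang loop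
   these two identities make a normal subloop X induce an abelian congruence:
   every term operation is affine along X. Hence Q is congruence solvable as
   soon as Mlt(Q) is solvable.

   Solvability of Mlt(Q) is climbed along a classical series. Let D be normal in
   X with X/D a commutative group, and let A be generated by the L_d, d in D. The
   conjugates of A under M(X) normalize each other, so their join is solvable if
   A is; the same holds for right translations, by conjugation with the inversion
   map. Modulo these two joins, the identities L_(zx) = R_z^-1 L_x R_z L_z and
   R_(yz) = L_z^-1 R_y L_z R_z (products from left to right) force M(X) to be
   nilpotent of class at most 2. *)
From HB Require Import structures.
From mathcomp Require Import all_boot all_fingroup all_solvable.
From mathcomp Require Import generic_quotient.
Require Import Defs.

Set Implicit Arguments.
Unset Strict Implicit.
Unset Printing Implicit Defensive.

Local Open Scope quotient_scope.
Local Open Scope loop_scope.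

(** * Identities in loops and Moufang loops *)

Section LoopTheory.

Variable Q : loopType.
Implicit Types x y z u v w : Q.

Lemma lmulI u : injective (lmul u). Proof. exact: can_inj (ldivK u). Qed.

Lemma lmulIr u : injective (fun v : Q => v * u).
Proof. exact: (can_inj (g := fun v => rdiv v u) (rmulK u)). Qed.

Lemma ldiv_eq u v w : u * v = w -> ldiv u w = v.
Proof. by move <-; rewrite ldivK. Qed.

Lemma rdiv_eq u v w : u * v = w -> rdiv w v = u.
Proof. by move <-; rewrite rmulK. Qed.

End LoopTheory.

Section MoufangTheory.

Variables (Q : loopType) (mQ : moufang Q).
Implicit Types x y z u v w : Q.

Definition linv x : Q := ldiv x 1.

Lemma lmulxV x : x * linv x = 1. Proof. exact: lmulK. Qed.

Lemma lmulKV x y : linv x * (x * y) = y.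
Proof. by apply: (@lmulI _ x); rewrite mQ lmulxV lmul1x. Qed.

Lemma lmulVx x : linv x * x = 1.
Proof. by have := lmulKV x 1; rewrite lmulx1. Qed.

Lemma linvK x : linv (linv x) = x.
Proof. by apply: (@lmulI _ (linv x)); rewrite lmulxV lmulVx. Qed.

Lemma lmulVK x y : x * (linv x * y) = y.
Proof. by rewrite -{1}[x]linvK lmulKV. Qed.

Lemma flexible x y : x * (y * x) = (x * y) * x.
Proof. by have := mQ x y 1; rewrite !lmulx1. Qed.

Lemma rmulKV x y : (y * x) * linv x = y.
Proof.
have := mQ x (linv x * y) (linv x * 1).
by rewrite !lmulx1 lmulxV lmulx1 !lmulVK.
Qed.

Lemma rmulVK x y : (y * linv x) * x = y.
Proof. by rewrite -{2}[x]linvK rmulKV. Qed.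

Lemma linvM x y : linv (x * y) = linv y * linv x.
Proof. by rewrite -[linv y](lmulKV (x * y)) !rmulKV. Qed.

Lemma linv_inj : injective linv. Proof. exact: can_inj linvK. Qed.

(** [linv] is an antiautomorphism, so it carries the left Moufang identity to its mirror image. *)
Lemma right_moufang x y z : ((z * x) * y) * x = z * (x * (y * x)).
Proof.
by apply: linv_inj; rewrite !linvM mQ -flexible.
Qed.

Lemma right_alternative x z : (z * x) * x = z * (x * x).
Proof. by have := right_moufang x 1 z; rewrite lmulx1 lmul1x. Qed.

(** This and the next identity exhibit each translation as the product component of an autotopism;
    [autotopic_translations] rests on them. *)
Lemma left_autotopism x a b : x * (a * b) = (x * (a * x)) * (linv x * b).
Proof. by rewrite flexible -mQ lmulVK. Qed.

Lemma right_autotopism x a b : (a * b) * x = (a * linv x) * (x * (b * x)).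
Proof. by rewrite -right_moufang rmulVK. Qed.

(** Compose the left and the right autotopism of [x]: the factors [linv x] cancel in both
    components. *)
Lemma middle_moufang x a b : (x * a) * (b * x) = (x * (a * b)) * x.
Proof.
rewrite [x * (a * b)]left_autotopism [RHS]right_autotopism [x * (a * x)]flexible rmulKV.
by rewrite [x * (_ * x)]flexible lmulVK.
Qed.

End MoufangTheory.

(* The fields idealM, idealL, idealR express that u ~ v <-> u \ v \in X is
   compatible with the three operations. *)
Record abelian_ideal (Q : loopType) (X : {pred Q}) : Prop := AbelianIdeal {
  ideal1 : 1 \in X;
  idealM u v x y : x \in X -> y \in X -> ldiv (u * v) ((u * x) * (v * y)) \in X;
  idealL u v x y : x \in X -> y \in X -> ldiv (ldiv u v) (ldiv (u * x) (v * y)) \in X;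
  idealR u v x y : x \in X -> y \in X -> ldiv (rdiv u v) (rdiv (u * x) (v * y)) \in X;
  idealC x y : x \in X -> y \in X -> x * y = y * x;
  idealA u x y : x \in X -> y \in X -> (u * x) * y = u * (x * y)
}.

(** * Additivity of multiplication along an abelian ideal *)

Section AbelianIdeal.

Variables (Q : loopType) (mQ : moufang Q) (X : {pred Q}) (abX : abelian_ideal X).
Implicit Types x y z u v w : Q.

Lemma ideal_mul x y : x \in X -> y \in X -> x * y \in X.
Proof.
move=> Xx Xy; have := idealM abX 1 1 Xx Xy.
by rewrite !lmul1x (ldiv_eq (lmul1x _)).
Qed.

Lemma ideal_inv x : x \in X -> linv x \in X.
Proof.
move=> Xx; have := idealL abX 1 1 Xx (ideal1 abX).
by rewrite !lmul1x (ldiv_eq (lmul1x _)) (ldiv_eq (lmul1x _)).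
Qed.

Lemma ideal_right_assoc v x y : x \in X -> y \in X -> x * (y * v) = (x * y) * v.
Proof.
move=> Xx Xy; apply: linv_inj => //; rewrite !linvM //.
by rewrite (idealA abX) ?ideal_inv.
Qed.

Definition ideal_conj v x := ldiv v (x * v).

Lemma ideal_conj_in v x : x \in X -> ideal_conj v x \in X.
Proof.
move=> Xx; have := idealM abX 1 v Xx (ideal1 abX).
by rewrite !lmul1x lmulx1.
Qed.

Lemma ideal_conjM v x y : x \in X -> y \in X ->
  ideal_conj v (x * y) = ideal_conj v x * ideal_conj v y.
Proof.
move=> Xx Xy; apply: ldiv_eq; rewrite -(idealA abX) ?ideal_conj_in // lmulK.
(* In this form [ideal_conj v y] is the second component of the right autotopism of [linv v] at
   [y * (v * v)], so its product with [x * v] collapses. *)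
have -> : ideal_conj v y = linv v * ((y * (v * v)) * linv v).
  by apply: ldiv_eq; rewrite lmulVK // -right_alternative // rmulKV.
rewrite -{1}[v](linvK mQ) -right_autotopism // ideal_right_assoc //.
by rewrite -right_alternative // rmulKV.
Qed.

Definition ideal_inner u v x := ldiv (u * v) (u * (v * x)).

Lemma ideal_inner_in u v x : x \in X -> ideal_inner u v x \in X.
Proof. by move=> Xx; have := idealM abX u v (ideal1 abX) Xx; rewrite lmulx1. Qed.

(** The right autotopism of [g], applied to [x] and [y * linv g], with [ideal_right_assoc] to pull
    out [x * y]. *)
Lemma ideal_shift g x y : x \in X -> y \in X -> (x * linv g) * (g * y) = x * y.
Proof.
move=> Xx Xy; rewrite -{1}[y](rmulVK mQ g) -right_autotopism //.
by rewrite ideal_right_assoc // rmulVK.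
Qed.

(* The inner mapping L_(uv)^-1 L_u L_v is a component of an autotopism whose
   other components differ from it by translations by
   g = (uv)(u^-1 v^-1) and its inverse; those cancel by [ideal_shift]. *)
Lemma ideal_innerM u v x y : x \in X -> y \in X ->
  ideal_inner u v (x * y) = ideal_inner u v x * ideal_inner u v y.
Proof.
move=> Xx Xy.
pose F x := linv (u * v) * ((u * ((v * (x * v)) * u)) * linv (u * v)).
pose G y := (u * v) * (linv u * (linv v * y)).
have E a b : ideal_inner u v (a * b) = F a * G b.
  apply: ldiv_eq; rewrite /F /G -{4}[u * v](linvK mQ) -(left_autotopism mQ) lmulVK //.
  by rewrite -(left_autotopism mQ u) -(left_autotopism mQ v).
have F1 : F 1 * G 1 = 1 by rewrite -E lmulx1; apply: ldiv_eq; rewrite !lmulx1.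
have Fx a : ideal_inner u v a = F a * G 1 by rewrite -E lmulx1.
have Gy b : ideal_inner u v b = F 1 * G b by rewrite -E lmul1x.
have F1E : F 1 = linv (G 1) by rewrite -[F 1](rmulKV mQ (G 1)) F1 lmul1x.
rewrite E -[RHS](ideal_shift (G 1)) ?ideal_inner_in // Fx rmulKV // Gy F1E lmulVK //.
Qed.

Definition ideal_prod u v x y := ldiv (u * v) ((u * x) * (v * y)).

(** Middle Moufang gives (xv)(yx) = (x(vy))x, and right Moufang turns u times this into ((ux)(vy))x;
    the trailing x is then cancelled by [linv x]. Thus [ideal_prod] is assembled from maps already
    known to be additive. *)
Lemma ideal_prodE u v x y : x \in X -> y \in X ->
  ideal_prod u v x y = ideal_inner u v ((ideal_conj v x * y) * x) * linv x.
Proof.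
move=> Xx Xy; apply: ldiv_eq.
have Tx := ideal_conj_in v Xx.
rewrite -(idealA abX) ?ideal_inv ?ideal_inner_in ?ideal_mul // lmulK.
rewrite (idealA abX (ideal_conj v x)) // -(idealA abX v) ?ideal_mul // lmulK.
by rewrite middle_moufang // -flexible // -right_moufang // rmulKV.
Qed.

Lemma ideal_prodM u v x y x' y' : x \in X -> y \in X -> x' \in X -> y' \in X ->
  ideal_prod u v (x * x') (y * y') = ideal_prod u v x y * ideal_prod u v x' y'.
Proof.
move=> Xx Xy Xx' Xy'; have Tx := ideal_conj_in v Xx; have Tx' := ideal_conj_in v Xx'.
have CA a b c d : a \in X -> b \in X -> c \in X -> d \in X ->
    (a * b) * (c * d) = (a * c) * (b * d).
  move=> Xa Xb Xc Xd; rewrite !(idealA abX) ?ideal_mul //; congr (_ * _).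
  by rewrite -!(idealA abX) // (idealC abX Xb).
rewrite !ideal_prodE ?ideal_mul // ideal_conjM // linvM //.
rewrite (CA _ _ y y') // (CA _ _ x x') ?ideal_mul //.
rewrite [linv x' * _](idealC abX) ?ideal_inv // ideal_innerM ?ideal_mul //.
by rewrite CA ?ideal_inv ?ideal_inner_in ?ideal_mul.
Qed.

End AbelianIdeal.

(** * Term operations are affine along an abelian ideal *)

Lemma eq_term_op (Q : loopType) n (t : loop_term n) (e f : 'I_n -> Q) :
  e =1 f -> term_op t e = term_op t f.
Proof. by move=> ef; elim: t => //= [t1 -> t2 ->|t1 -> t2 ->|t1 -> t2 ->]. Qed.

Section IdealTerms.

Variables (Q : loopType) (mQ : moufang Q) (X : {pred Q}) (abX : abelian_ideal X).
Implicit Types x y z u v w : Q.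

Definition ideal_ldiv u v x y := ldiv (ldiv u v) (ldiv (u * x) (v * y)).

(** For fixed [x], left division inverts a multiplication map, so it inherits the additivity of
    [ideal_prod]; [ideal_rdivP] does the same on the other side. *)
Lemma ideal_ldivP u v x y : ideal_prod u (ldiv u v) x (ideal_ldiv u v x y) = y.
Proof. by apply: ldiv_eq; rewrite !lmulK. Qed.

Lemma ideal_ldivM u v x y x' y' : x \in X -> y \in X -> x' \in X -> y' \in X ->
  ideal_ldiv u v (x * x') (y * y') = ideal_ldiv u v x y * ideal_ldiv u v x' y'.
Proof.
move=> Xx Xy Xx' Xy'; apply/ldiv_eq/esym/ldiv_eq.
rewrite -{2}[y](ideal_ldivP u v x) -{2}[y'](ideal_ldivP u v x').
by rewrite -(ideal_prodM mQ abX) ?(idealL abX) // /ideal_prod !lmulK.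
Qed.

Definition ideal_rdiv u v x y := ldiv (rdiv u v) (rdiv (u * x) (v * y)).

Lemma ideal_rdivP u v x y : ideal_prod (rdiv u v) v (ideal_rdiv u v x y) y = x.
Proof. by apply: ldiv_eq; rewrite lmulK !rdivK. Qed.

Lemma ideal_rdivM u v x y x' y' : x \in X -> y \in X -> x' \in X -> y' \in X ->
  ideal_rdiv u v (x * x') (y * y') = ideal_rdiv u v x y * ideal_rdiv u v x' y'.
Proof.
move=> Xx Xy Xx' Xy'; apply/ldiv_eq/esym/rdiv_eq.
rewrite -{2}[x](ideal_rdivP u v x y) -{2}[x'](ideal_rdivP u v x' y').
by rewrite -(ideal_prodM mQ abX) ?(idealR abX) // /ideal_prod rdivK lmulK.
Qed.

Definition term_diff n (t : loop_term n) (e p : 'I_n -> Q) :=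
  ldiv (term_op t e) (term_op t (fun i => e i * p i)).

Lemma term_diffE n (t : loop_term n) e p :
  term_op t (fun i => e i * p i) = term_op t e * term_diff t e p.
Proof. by rewrite lmulK. Qed.

Lemma term_diffMul n (t1 t2 : loop_term n) e p :
  term_diff (TMul t1 t2) e p
  = ideal_prod (term_op t1 e) (term_op t2 e) (term_diff t1 e p) (term_diff t2 e p).
Proof. by rewrite /ideal_prod -!term_diffE. Qed.

Lemma term_diffLdiv n (t1 t2 : loop_term n) e p :
  term_diff (TLdiv t1 t2) e p
  = ideal_ldiv (term_op t1 e) (term_op t2 e) (term_diff t1 e p) (term_diff t2 e p).
Proof. by rewrite /ideal_ldiv -!term_diffE. Qed.

Lemma term_diffRdiv n (t1 t2 : loop_term n) e p :
  term_diff (TRdiv t1 t2) e p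
  = ideal_rdiv (term_op t1 e) (term_op t2 e) (term_diff t1 e p) (term_diff t2 e p).
Proof. by rewrite /ideal_rdiv -!term_diffE. Qed.

Definition term_diff_simp := (term_diffMul, term_diffLdiv, term_diffRdiv).

Lemma term_diff_in n (t : loop_term n) e p :
  (forall i, p i \in X) -> term_diff t e p \in X.
Proof.
move=> Xp; elim: t => [i||t1 X1 t2 X2|t1 X1 t2 X2|t1 X1 t2 X2]; rewrite ?term_diff_simp.
- by rewrite /term_diff ldivK.
- by rewrite /term_diff (ldiv_eq (lmulx1 _)) (ideal1 abX).
- by apply: (idealM abX).
- by apply: (idealL abX).
- by apply: (idealR abX).
Qed.

Lemma term_diffM n (t : loop_term n) e p q :
    (forall i, p i \in X) -> (forall i, q i \in X) ->
  term_diff t e (fun i => p i * q i) = term_diff t e p * term_diff t e q.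
Proof.
move=> Xp Xq; elim: t => [i||t1 E1 t2 E2|t1 E1 t2 E2|t1 E1 t2 E2]; rewrite ?term_diff_simp.
- by rewrite /term_diff !ldivK.
- by rewrite /term_diff !(ldiv_eq (lmulx1 _)) lmulx1.
- by rewrite E1 E2 (ideal_prodM mQ abX) ?term_diff_in.
- by rewrite E1 E2 ideal_ldivM ?term_diff_in.
- by rewrite E1 E2 ideal_rdivM ?term_diff_in.
Qed.

End IdealTerms.

Lemma env_cons0 (T : Type) n (a : T) (u : 'I_n -> T) : env_cons a u ord0 = a.
Proof. by rewrite /env_cons unlift_none. Qed.

Lemma env_consS (T : Type) n (a : T) (u : 'I_n -> T) i : env_cons a u (lift ord0 i) = u i.
Proof. by rewrite /env_cons liftK. Qed.

Lemma abelian_ideal_congruence (Q : finLoopType) (mQ : moufang Q) (X : {set Q}) :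
  abelian_ideal X -> induces_abelian_congruence X.
Proof.
move=> abX n t a b u v.
have cosetP c d : coset_rel X c d -> ldiv c d \in X.
  move=> /eqP E; have : d \in loop_coset X d.
    by rewrite -{1}[d]lmulx1; apply: imset_f; apply: ideal1 abX.
  by rewrite -E => /imsetP[x Xx ->]; rewrite ldivK.
move=> /cosetP Xab auv eqt; have Xuv i := cosetP _ _ (auv i).
(* The base point is (a, u); [p] moves only a to b, and [q] moves only each u_i to v_i. The assumed
   equality says that the displacement along [q] is 1, so by additivity [p] and [p q] have the same
   displacement. *)
pose e := env_cons a u.
pose p := env_cons (ldiv a b) (fun _ : 'I_n => 1 : Q).
pose q := env_cons 1 (fun i => ldiv (u i) (v i)).
have Xp i : p i \in X.
  rewrite /p /q; case: (unliftP ord0 i) => [j|] ->; rewrite ?env_cons0 ?env_consS //.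
  exact: ideal1 abX.
have Xq i : q i \in X.
  rewrite /p /q; case: (unliftP ord0 i) => [j|] ->; rewrite ?env_cons0 ?env_consS //.
  exact: ideal1 abX.
have ep : env_cons b u =1 (fun i => e i * p i).
  by rewrite /e /p /q => i; case: (unliftP ord0 i) => [j|] ->;
    rewrite ?env_cons0 ?env_consS ?lmulK ?lmulx1.
have eq : env_cons a v =1 (fun i => e i * q i).
  by rewrite /e /p /q => i; case: (unliftP ord0 i) => [j|] ->;
    rewrite ?env_cons0 ?env_consS ?lmulK ?lmulx1.
have epq : env_cons b v =1 (fun i => e i * (p i * q i)).
  rewrite /e /p /q => i; case: (unliftP ord0 i) => [j|] ->;
    rewrite ?env_cons0 ?env_consS ?lmul1x ?lmulx1 ?lmulK //.
have q1 : term_diff t e q = 1.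
  by apply: ldiv_eq; rewrite -(eq_term_op t eq) -eqt lmulx1.
rewrite (eq_term_op t ep) (eq_term_op t epq) (term_diffE t e (fun i => p i * q i)).
by rewrite (term_diffM mQ abX) // q1 lmulx1 -term_diffE.
Qed.

(** * Cosets, quotients and translations *)

Section SubloopCosets.

Variables (Q : finLoopType) (X : subloop Q) (nX : normal_subloop X).

Lemma mem_loop_coset u v : (v \in loop_coset X u) = (ldiv u v \in subloop_set X).
Proof.
apply/imsetP/idP => [[x Xx ->]|Xuv]; first by rewrite ldivK.
by exists (ldiv u v); rewrite ?lmulK.
Qed.

Lemma coset_relE u v : coset_rel X u v = (ldiv u v \in subloop_set X).
Proof.
rewrite -mem_loop_coset; apply/eqP/idP => [->|].
  by rewrite mem_loop_coset (ldiv_eq (lmulx1 _)) subloop1.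
rewrite mem_loop_coset => Xuv; apply/eqP.
suff: coset_rel X (u * 1) (u * ldiv u v) by rewrite lmulx1 lmulK.
rewrite coset_rel_mul2l //; apply/eqP/setP => w.
rewrite !mem_loop_coset (ldiv_eq (lmul1x _)); apply/idP/idP => [Xw|Xw].
  exact: subloopL.
by rewrite -[w](lmulK (ldiv u v)) subloopM.
Qed.

Local Notation QX := (quotient_loop nX).
Local Notation pi u := (\pi_QX u : QX).

Lemma quotM u v : pi u * pi v = pi (u * v). Proof. exact: pi_mul. Qed.
Lemma quotL u v : ldiv (pi u) (pi v) = pi (ldiv u v). Proof. exact: pi_ldiv. Qed.
Lemma quotR u v : rdiv (pi u) (pi v) = pi (rdiv u v). Proof. exact: pi_rdiv. Qed.

Lemma quot_eq u v : (pi u = pi v) <-> (ldiv u v \in subloop_set X).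
Proof. by rewrite -coset_relE; split => E; apply/eqquotP; first exact: E. Qed.

End SubloopCosets.

Lemma quotient_moufang (Q : finLoopType) (X : subloop Q) (nX : normal_subloop X) :
  moufang Q -> moufang (quotient_loop nX).
Proof.
move=> mQ; elim/quotW=> u; elim/quotW=> v; elim/quotW=> w.
rewrite (quotM nX u w) (quotM nX v) (quotM nX u (v * _)) mQ.
by rewrite (quotM nX u v) (quotM nX (u * v)) (quotM nX (u * v * u)).
Qed.

Lemma ltrans_E (Q : finLoopType) (u v : Q) : ltrans u v = u * v.
Proof. by rewrite permE. Qed.

Lemma rtrans_E (Q : finLoopType) (u v : Q) : rtrans u v = v * u.
Proof. by rewrite permE. Qed.

Lemma ltransV_E (Q : finLoopType) (u v : Q) : (ltrans u)^-1%g v = ldiv u v.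
Proof. by apply: (@perm_inj _ (ltrans u)); rewrite permKV ltrans_E lmulK. Qed.

Lemma rtransV_E (Q : finLoopType) (u v : Q) : (rtrans u)^-1%g v = rdiv v u.
Proof. by apply: (@perm_inj _ (rtrans u)); rewrite permKV rtrans_E rdivK. Qed.

Definition trans_E := (ltrans_E, rtrans_E, ltransV_E, rtransV_E).

Lemma ltrans1 (Q : finLoopType) : ltrans (1 : Q) = 1%g.
Proof. by apply/permP => v; rewrite trans_E perm1 lmul1x. Qed.

Lemma rtrans1 (Q : finLoopType) : rtrans (1 : Q) = 1%g.
Proof. by apply/permP => v; rewrite trans_E perm1 lmulx1. Qed.

(** * Autotopisms with components in a permutation group *)

Section Autotopisms.

Variable Q : finLoopType.
Implicit Types (g h : {perm Q}) (H N : {group {perm Q}}).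

(** The second factors of autotopisms whose other two components lie in [H]. The condition
    [H \subset autotopic H] is what descends along the derived series. *)
Definition autotopic (H : {set {perm Q}}) : {set {perm Q}} :=
  [set g : {perm Q} | [exists a : {perm Q} in H, exists c : {perm Q} in H,
    forall x, forall y, c (x * y) == a x * g y]].

Lemma autotopicP (H : {set {perm Q}}) g :
  reflect (exists a c, [/\ a \in H, c \in H & forall x y, c (x * y) = a x * g y])
          (g \in autotopic H).
Proof.
rewrite inE; apply: (iffP exists_inP) => [[a Ha /exists_inP[c Hc E]]|[a [c [Ha Hc E]]]].
  by exists a, c; split=> // x y; apply/eqP; move/forallP/(_ x)/forallP/(_ y): E.
by exists a => //; apply/exists_inP; exists c => //; apply/'forall_forallP => x y; apply/eqP.
Qed.

Lemma autotopic_group_set H : group_set (autotopic H).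
Proof.
apply/group_setP; split=> [|g h /autotopicP[a [c [Ha Hc E]]] /autotopicP[a' [c' [Ha' Hc' E']]]].
  by apply/autotopicP; exists 1%g, 1%g; split=> // x y; rewrite !perm1.
by apply/autotopicP; exists (a * a')%g, (c * c')%g; split=> [||x y]; rewrite ?groupM // !permM E E'.
Qed.

Canonical autotopic_group H := Group (autotopic_group_set H).

(** Autotopisms compose and invert componentwise, so the commutator of two of them has commutators
    as components. *)
Lemma der1_autotopic H : H \subset autotopic H -> H^`(1)%g \subset autotopic H^`(1)%g.
Proof.
move=> sH; rewrite gen_subG; apply/subsetP => _ /imset2P[g h Hg Hh ->].
have /autotopicP[a [c [Ha Hc E]]] := subsetP sH _ Hg.
have /autotopicP[a' [c' [Ha' Hc' E']]] := subsetP sH _ Hh.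
have V (a1 c1 g1 : {perm Q}) : (forall x y, c1 (x * y) = a1 x * g1 y) ->
    forall x y, (c1^-1)%g (x * y) = (a1^-1)%g x * (g1^-1)%g y.
  by move=> E1 x y; apply: (@perm_inj _ c1); rewrite E1 !permKV.
apply/autotopicP; exists [~ a, a']%g, [~ c, c']%g; split=> [||x y]; try exact: mem_commg.
by rewrite !commgEl !conjgE !permM (V _ _ _ E) (V _ _ _ E') E E'.
Qed.

Definition translations (X : {set Q}) : {set {perm Q}} :=
  <<[set ltrans x | x in X] :|: [set rtrans x | x in X]>>%g.
Canonical translations_group X := [group of translations X].

Lemma ltrans_in (X : {set Q}) x : x \in X -> ltrans x \in translations X.
Proof. by move=> Xx; rewrite mem_gen // inE imset_f. Qed.

Lemma rtrans_in (X : {set Q}) x : x \in X -> rtrans x \in translations X.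
Proof. by move=> Xx; rewrite mem_gen // inE orbC imset_f. Qed.

Lemma translationsT : translations setT = Mlt Q.
Proof.
rewrite /translations /Mlt; congr <<_>>%g.
by apply/setP => g; rewrite !inE; congr (_ || _); apply/imsetP/imsetP => -[x _ ->]; exists x.
Qed.

Lemma autotopic_translations (X : {set Q}) :
  moufang Q -> translations X \subset autotopic (translations X).
Proof.
move=> mQ.
have lX x : x \in X -> ltrans x \in autotopic (translations X).
  (* The second component of the left autotopism is translation by [linv x], the inverse of
     [ltrans x]. *)
  move=> Xx; rewrite -groupV; apply/autotopicP.
  exists (rtrans x * ltrans x)%g, (ltrans x); split=> [||a b].
  - by rewrite groupM ?rtrans_in ?ltrans_in.
  - exact: ltrans_in.
  - rewrite permM !trans_E [LHS]left_autotopism //; congr (_ * _).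
    by apply/esym/ldiv_eq; rewrite lmulVK.
have rX x : x \in X -> rtrans x \in autotopic (translations X).
  (* The second component of the right autotopism is [rtrans x] followed by [ltrans x]; the latter
     is removed by [lX]. *)
  move=> Xx; rewrite -(groupMr _ (lX x Xx)); apply/autotopicP.
  exists (rtrans x)^-1%g, (rtrans x); split=> [||a b].
  - by rewrite groupV rtrans_in.
  - exact: rtrans_in.
  - rewrite permM !trans_E [LHS]right_autotopism //; congr (_ * _).
    by apply/esym/rdiv_eq; rewrite rmulVK.
by rewrite gen_subG; apply/subsetP => g /setUP[] /imsetP[x Xx ->]; [apply: lX|apply: rX].
Qed.

End Autotopisms.

(** * The orbit of 1 under a normal subgroup of Mlt(Q) *)

Section NormalOrbits.

Variables (Q : finLoopType) (mQ : moufang Q).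

Section Orbit.

Variable N : {group {perm Q}}.
Hypotheses (nN : (N <| Mlt Q)%g) (aN : N \subset autotopic N).

Local Notation Y := (orbit 'P N (1 : Q)%L).

Lemma mem_orbit_one g : g \in N -> g 1%L \in Y.
Proof. by move=> Ng; apply/orbitP; exists g. Qed.

(* If c(xz) = a(x)g(z) for all x, z, then c is a followed by right
   translation by g(1). *)
Lemma rtrans_orbit y : y \in Y -> rtrans y \in N.
Proof.
case/orbitP=> g Ng <-; have /autotopicP[a [c [Na Nc E]]] := subsetP aN _ Ng.
suff -> : rtrans (g 1%L) = (a^-1 * c)%g by rewrite groupM ?groupV.
by apply/permP => x; rewrite permM -[_ x in RHS]lmulx1 E permKV trans_E.
Qed.

Lemma orbit_mul : {in Y &, forall x y, x * y \in Y}.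
Proof.
move=> x y /orbitP[g Ng /= <-] Yy; rewrite apermE -rtrans_E -permM.
by rewrite mem_orbit_one // groupM // rtrans_orbit.
Qed.

Lemma orbit_inv x : x \in Y -> linv x \in Y.
Proof.
move=> Yx; have -> : linv x = (rtrans x)^-1%g 1%L by rewrite trans_E; apply/esym/rdiv_eq/lmulVx.
by rewrite mem_orbit_one // groupV rtrans_orbit.
Qed.

Lemma orbit_ldiv : {in Y &, forall x y, ldiv x y \in Y}.
Proof.
move=> x y Yx Yy; suff -> : ldiv x y = linv x * y by rewrite orbit_mul ?orbit_inv.
by apply: ldiv_eq; rewrite lmulVK.
Qed.

Lemma orbit_rdiv : {in Y &, forall x y, rdiv x y \in Y}.
Proof.
move=> x y Yx Yy; suff -> : rdiv x y = x * linv y by rewrite orbit_mul ?orbit_inv.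
by apply: rdiv_eq; rewrite rmulVK.
Qed.

Definition orbit_subloop : subloop Q :=
  Subloop (orbit_refl 'P%act N 1%L) orbit_mul orbit_ldiv orbit_rdiv.

(** An inner mapping f fixes 1, so it sends g(1) to the image of 1 under the conjugate [g ^ f],
    which is again in [N]. *)
Lemma orbit_subloop_normal : normal_subloop orbit_subloop.
Proof.
apply/subsetP => f; rewrite inE => /andP[Mf /astab1P f1].
rewrite inE; apply/andP; split; rewrite inE //.
apply/subsetP => _ /orbitP[g Ng /= <-]; rewrite inE !apermE.
have fV1 : (f^-1)%g 1%L = 1%L by rewrite -{1}f1 /= apermE permK.
have -> : f (g 1%L) = (g ^ f)%g 1%L by rewrite conjgE !permM fV1.
by rewrite mem_orbit_one // memJ_norm // (subsetP (normal_norm nN)).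
Qed.

End Orbit.

Variable N : {group {perm Q}}.
Hypotheses (nN : (N <| Mlt Q)%g) (aN : N \subset autotopic N).

Lemma der1_normal_Mlt : (N^`(1) <| Mlt Q)%g.
Proof. exact: char_normal_trans (der_char 1 N) nN. Qed.

Local Notation S := (orbit_subloop aN).

Lemma conj_ltrans u h : h \in N -> (ltrans u * h * (ltrans u)^-1)%g \in N.
Proof.
move=> Nh; have -> : (ltrans u * h * (ltrans u)^-1 = h ^ (ltrans u)^-1)%g.
  by rewrite conjgE invgK mulgA.
by rewrite memJ_norm // groupV (subsetP (normal_norm nN)) ?ltrans_Mlt.
Qed.

(** Conjugation by the translation of [u] moves the base point from [u] to 1; hence [N] moves every
    point within its coset. *)
Lemma orbit_coset h u : h \in N -> ldiv u (h u) \in subloop_set S.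
Proof.
move=> Nh; have -> : ldiv u (h u) = (ltrans u * h * (ltrans u)^-1)%g 1%L.
  by rewrite !permM !trans_E lmulx1.
by apply: mem_orbit_one; apply: conj_ltrans.
Qed.

End NormalOrbits.

(** * The orbit of N modulo the orbit of its derived group *)

Section DerivedOrbits.

Variables (Q : finLoopType) (mQ : moufang Q) (N : {group {perm Q}}).
Hypotheses (nN : (N <| Mlt Q)%g) (aN : N \subset autotopic N).

Local Notation S := (orbit_subloop mQ aN).
Local Notation S' := (orbit_subloop mQ (der1_autotopic aN)).

Let nS : normal_subloop S := orbit_subloop_normal mQ nN aN.
Let nS' : normal_subloop S' := orbit_subloop_normal mQ (der1_normal_Mlt nN) (der1_autotopic aN).

(** The two values differ by a commutator, which lies in the derived group and so preserves cosets
    of its orbit. *)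
Lemma derived_orbit_comm g h : g \in N -> h \in N -> coset_rel S' (g (h 1%L)) (h (g 1%L)).
Proof.
move=> Ng Nh; rewrite coset_relE //.
have -> : h (g 1%L) = [~ g, h]%g (g (h 1%L)) by rewrite -(permM g h) commgC !permM.
by apply: (orbit_coset mQ (der1_normal_Mlt nN)); rewrite mem_commg.
Qed.

Lemma derived_orbit_ideal : abelian_ideal (quotient_set nS' S).
Proof.
have idl u v : coset_rel S u v -> ldiv u v \in subloop_set S by rewrite coset_relE.
have cS u x : x \in subloop_set S -> coset_rel S u (u * x).
  by move=> Sx; rewrite coset_relE // ldivK.
split.
- by apply/imsetP; exists 1; rewrite ?subloop1.
- elim/quotW=> u; elim/quotW=> v _ _ /imsetP[x Sx ->] /imsetP[y Sy ->].
  rewrite (quotM _ u v) (quotM _ u x) (quotM _ v y) (quotM _ (u * x)) quotL.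
  by rewrite imset_f // idl // coset_relM // cS.
- elim/quotW=> u; elim/quotW=> v _ _ /imsetP[x Sx ->] /imsetP[y Sy ->].
  rewrite (quotM _ u x) (quotM _ v y) (quotL _ u v) (quotL _ (u * x)) quotL.
  by rewrite imset_f // idl // coset_relL // cS.
- elim/quotW=> u; elim/quotW=> v _ _ /imsetP[x Sx ->] /imsetP[y Sy ->].
  rewrite (quotM _ u x) (quotM _ v y) (quotR _ u v) (quotR _ (u * x)) quotL.
  by rewrite imset_f // idl // coset_relR // cS.
- move=> _ _ /imsetP[x Sx ->] /imsetP[y Sy ->]; rewrite (quotM _ x) (quotM _ y); apply/quot_eq.
  rewrite -coset_relE //; have := derived_orbit_comm (rtrans_orbit aN Sy) (rtrans_orbit aN Sx).
  by rewrite !trans_E !lmul1x.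
- elim/quotW=> u _ _ /imsetP[x Sx ->] /imsetP[y Sy ->].
  rewrite (quotM _ u x) (quotM _ x y) (quotM _ (u * x)) (quotM _ u (x * y)); apply/quot_eq.
  rewrite -coset_relE //; have Nx := rtrans_orbit aN Sx; have Ny := rtrans_orbit aN Sy.
  (* This map sends v to u \ ((uv)y) and 1 to y. Commuting it with right translation by x at 1 gives
     u \ ((ux)y) ~ yx, and yx ~ xy. *)
  have Nh : (ltrans u * rtrans y * (ltrans u)^-1)%g \in N.
    exact: conj_ltrans.
  have := derived_orbit_comm Nh Nx; rewrite !permM !trans_E lmul1x lmulx1 ldivK => E.
  rewrite -[u * x * y](lmulK u) coset_rel_mul2l //; apply: coset_rel_trans E _.
  by have := derived_orbit_comm Nx Ny; rewrite !trans_E !lmul1x.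
Qed.

End DerivedOrbits.

(** * Congruence solvability from solvability of Mlt(Q) *)

Section DerivedSeries.

Variables (Q : finLoopType) (mQ : moufang Q).

(** Bundling a group with both invariants lets the derived series be produced by [iter]. *)
Record derived_stage := DerivedStage {
  stage :> {group {perm Q}};
  stage_normal : (stage <| Mlt Q)%g;
  stage_autotopic : stage \subset autotopic stage
}.

Definition next_stage (N : derived_stage) : derived_stage :=
  DerivedStage (der1_normal_Mlt (stage_normal N)) (der1_autotopic (stage_autotopic N)).

Lemma Mlt_autotopic : Mlt Q \subset autotopic (Mlt Q).
Proof. by rewrite -translationsT autotopic_translations. Qed.

Definition first_stage : derived_stage := @DerivedStage (Mlt_group Q) (normal_refl _) Mlt_autotopic.

Lemma stage_derived n : iter n next_stage first_stage = (Mlt Q)^`(n)%g :> {set _}.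
Proof. by elim: n => [|n IHn] //; rewrite iterS /= IHn. Qed.

Lemma Mlt_solvable_congruence : solvable (Mlt Q) -> congruence_solvable Q.
Proof.
move=> /derivedP[n sn]; exists n.
exists (fun i => orbit_subloop mQ (stage_autotopic (iter i next_stage first_stage))).
split=> [||i lin].
- apply/setP => x; rewrite inE; apply/orbitP; exists (rtrans x); first exact: rtrans_Mlt.
  by rewrite /= apermE trans_E lmul1x.
- apply/setP => x; rewrite inE; apply/orbitP/eqP => [[g]|->].
    rewrite stage_derived sn inE => /eqP-> /= <-.
    by rewrite apermE perm1.
  by exists 1%g; rewrite ?group1 //= apermE perm1.
- set N := iter i next_stage first_stage; split.
    apply/subsetP => _ /orbitP[g Ng <-]; apply/orbitP; exists g => //.
    exact: subsetP (der_sub 1 N) _ Ng.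
  exists (orbit_subloop_normal mQ (stage_normal (next_stage N)) (stage_autotopic (next_stage N))).
  apply: abelian_ideal_congruence; first exact: quotient_moufang.
  exact: derived_orbit_ideal (stage_normal N) (stage_autotopic N).
Qed.

End DerivedSeries.

(** * Joins of solvable conjugates *)

Section SolvableGroups.

Variable gT : finGroupType.
Implicit Types (A B G H K R : {group gT}).

Local Open Scope group_scope.

Lemma solvableJ A x : solvable (A :^ x) = solvable A.
Proof. by have := injm_sol (injm_conj A x) (subxx A); rewrite morphim_conj setIid. Qed.

Lemma solvable_joinG R B K :
  R <| K -> B \subset K -> solvable R -> solvable B -> solvable (R <*> B).
Proof.
move=> nRK sBK sR sB; have nRB := subset_trans sBK (normal_norm nRK).
have nRY : R <| R <*> B by rewrite normalYl.
by rewrite (series_sol nRY) sR /= quotientYidl // quotient_sol.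
Qed.

(** The conjugates normalize each other, so each is normal in their join [K]. A maximal solvable
    normal subgroup of [K] therefore absorbs every conjugate. *)
Lemma solvable_class_support A G :
    solvable A -> (forall g, g \in G -> A \subset 'N(A :^ g)) ->
  solvable <<class_support A G>>.
Proof.
move=> sA nA; pose K := <<class_support A G>>%G; rewrite -/(gval K) -[<<_>>]/(gval K).
have sK g : g \in G -> A :^ g \subset K.
  move=> Gg; apply/subsetP => _ /imsetP[a Aa ->].
  by rewrite mem_gen //; apply/imset2P; exists a g.
have nK g : g \in G -> A :^ g <| K.
  move=> Gg; rewrite /normal sK // gen_subG; apply/subsetP => _ /imset2P[a h Aa Gh ->].
  rewrite /= -[g](mulgKV h) conjsgM normJ memJ_conjg.
  by rewrite (subsetP (nA _ _)) // groupM ?groupV.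
pose P R := (R <| K) && solvable R.
have [|R /maxgroupP[/andP[nR sR] maxR] _] := @maxgroup_exists _ P 1%G.
  by rewrite /P normal1 solvable1.
suff sKR : K \subset R by apply: solvableS sKR sR.
rewrite gen_subG; apply/subsetP => _ /imset2P[a h Aa Gh ->].
have E : (R <*> A :^ h)%G = R :> {set gT}.
  apply: maxR; last exact: joing_subl.
  rewrite /P (normalY nR (nK _ Gh)) /=.
  by apply: (@solvable_joinG R (A :^ h)%G K); rewrite ?sK ?solvableJ.
by rewrite -E mem_gen // inE orbC memJ_conjg Aa.
Qed.

End SolvableGroups.

(** * Groups generated by two mutually twisted families *)

Section ClassTwo.

Variables (gT : finGroupType) (I : finType) (op : I -> I -> I) (l r : I -> gT).

Local Open Scope group_scope.

Hypothesis lM : forall x z, l (op z x) = l x ^ r z * l z.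
Hypothesis rM : forall y z, r (op y z) = r y ^ l z * r z.
Hypotheses (lC : forall x y, l (op x y) = l (op y x)) (rC : forall x y, r (op x y) = r (op y x)).
Hypothesis lA : forall x y z, l (op x (op y z)) = l (op (op x y) z).
Hypothesis rA : forall x y z, r (op x (op y z)) = r (op (op x y) z).

(* Associativity of the index operation makes D commute with the l x and E with
   the r x; since E y z = (D z y)^-1, both are central. *)
Let D y z := r y * (r y ^ l z)^-1.
Let E y z := l y * (l y ^ r z)^-1.

(** Expand [l] at both bracketings of a triple product and use [rC]: [l x] has the same conjugate by
    [r y] and by [r y ^ l z]. [E_r] is the mirror image. *)
Let D_l x y z : commute (D y z) (l x).
Proof.
have := lA z y x; rewrite !lM conjMg -mulgA -conjgM => /mulIg.
rewrite rC rM (conjgM _ (r y)) (conjgM _ (r y ^ l z)) => /conjg_inj H.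
by apply/commute_sym/commgP/conjg_fixP; rewrite /D (conjgM _ (r y)) H conjgK.
Qed.

Let E_r x y z : commute (E y z) (r x).
Proof.
have := rA x y z; rewrite !rM conjMg -conjgM (mulgA (r x ^ l (op y z))) => /mulIg/mulIg.
rewrite lC lM (conjgM _ (l y)) (conjgM _ (l y ^ r z)) => /conjg_inj H.
by apply/commute_sym/commgP/conjg_fixP; rewrite /E (conjgM _ (l y)) -H conjgK.
Qed.

(** Conjugating [D z y] by the inverse of [l y] and [E y z] by the inverse of [r z] changes neither,
    and the results are visibly mutually inverse commutators. *)
Let E_D y z : E y z = (D z y)^-1.
Proof.
have -> : D z y = D z y ^ (l y)^-1 by apply/esym/conjg_fixP/commgP/commuteV/D_l.
apply: (mulgI (D z y ^ (l y)^-1)); rewrite mulgV.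
have -> : E y z = E y z ^ (r z)^-1 by apply/esym/conjg_fixP/commgP/commuteV/E_r.
by rewrite /D /E !conjgE !invMg !invgK !mulgA !(mulgK, mulgKV, mulgV).
Qed.

Lemma class_two_solvable : solvable <<[set l x | x in I] :|: [set r x | x in I]>>.
Proof.
set S := _ :|: _; set G := <<S>>%G.
have Gl x : l x \in G by rewrite mem_gen // inE imset_f.
have Gr x : r x \in G by rewrite mem_gen // inE orbC imset_f.
have ZE y z : E y z \in 'Z(G).
  apply/centerP; split; first by rewrite groupM ?groupV ?groupJ.
  suff: G \subset 'C[E y z] by move=> /subsetP H x /H /cent1P/commute_sym.
  rewrite gen_subG; apply/subsetP => _ /setUP[] /imsetP[x _ ->]; apply/cent1P;
    last exact/commute_sym/E_r.
  by rewrite E_D; apply/commuteV/commute_sym/D_l.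
have ZD y z : D y z \in 'Z(G) by rewrite -groupV -E_D.
rewrite (series_sol (center_normal G)) abelian_sol ?center_abelian //=.
apply: abelian_sol; suff: abelian <<S / 'Z(G)>>.
  rewrite -quotient_gen // (subset_trans (subset_gen _)) //.
  exact: (normal_norm (center_normal G)).
have nZ x : x \in G -> x \in 'N('Z(G)) by apply/subsetP/normal_norm/center_normal.
pose c := coset_morphism 'Z(G).
(* Modulo the centre each [l y] commutes with each [r z], so [lM] and [rM] lose their conjugations
   and [lC], [rC] give commutativity within each family. *)
have cE y z : c (l y) = c (l y) ^ c (r z).
  have : c (E y z) = 1 by exact: coset_id.
  rewrite morphM ?groupV ?groupJ ?nZ // morphV ?groupJ ?nZ // morphJ ?nZ //.
  by move/eqP; rewrite -eq_mulgV1 => /eqP.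
have cD y z : c (r y) = c (r y) ^ c (l z).
  have : c (D y z) = 1 by exact: coset_id.
  rewrite morphM ?groupV ?groupJ ?nZ // morphV ?groupJ ?nZ // morphJ ?nZ //.
  by move/eqP; rewrite -eq_mulgV1 => /eqP.
have cl y z : c (l (op y z)) = c (l z) * c (l y).
  by rewrite lM morphM ?groupJ ?nZ // morphJ ?nZ // -cE.
have cr y z : c (r (op y z)) = c (r y) * c (r z).
  by rewrite rM morphM ?groupJ ?nZ // morphJ ?nZ // -cD.
have clr y z : commute (c (l y)) (c (r z)).
  by apply/commgP/conjg_fixP; rewrite -cE.
rewrite abelian_gen; apply/centsP => _ /morphimP[g _ /setUP[] /imsetP[x _ ->] ->]
    _ /morphimP[h _ /setUP[] /imsetP[y _ ->] ->].
- by rewrite /commute -cl lC cl.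
- exact: clr.
- exact/commute_sym/clr.
- by rewrite /commute -cr rC cr.
Qed.

End ClassTwo.

(** * Relations between translations; inversion swaps the two sides *)

Section TranslationRelations.

Variables (Q : finLoopType) (mQ : moufang Q).
Implicit Types x y z : Q.

Local Open Scope group_scope.

Lemma ltransM z x : ltrans (z * x)%L = ltrans x ^ rtrans z * ltrans z.
Proof.
apply/permP => y; rewrite conjgE !permM !trans_E.
by rewrite -{1}[y](rdivK z) middle_moufang // flexible.
Qed.

Lemma rtransM y z : rtrans (y * z)%L = rtrans y ^ ltrans z * rtrans z.
Proof.
apply/permP => x; rewrite conjgE !permM !trans_E.
by rewrite -{1}[x](lmulK z) middle_moufang.
Qed.

Lemma ltrans_moufang (w p : Q) : ltrans w * ltrans p * ltrans w = ltrans ((w * p) * w)%L.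
Proof. by apply/permP => v; rewrite !permM !trans_E mQ. Qed.

(** Conjugation by this involution exchanges left translations with inverses of right ones, which
    transfers results on left translations to the right. *)
Definition linv_perm : {perm Q} := perm (linv_inj mQ).

Lemma linv_permV : linv_perm^-1 = linv_perm.
Proof.
apply/permP => x; apply: (@perm_inj _ linv_perm); rewrite permKV.
by rewrite !permE linvK.
Qed.

Lemma ltransJ x : ltrans x ^ linv_perm = (rtrans x)^-1.
Proof.
apply/permP => v; rewrite conjgE !permM linv_permV !trans_E !permE /= linvM // linvK //.
by apply/esym/rdiv_eq; rewrite rmulVK.
Qed.

Lemma rtransJ x : rtrans x ^ linv_perm = (ltrans x)^-1.
Proof. by rewrite -[rtrans x]invgK conjVg -ltransJ -conjgM -{1}linv_permV mulVg conjg1. Qed.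

Lemma translationsJ (X : {set Q}) : translations X :^ linv_perm = translations X.
Proof.
apply/eqP; rewrite eqEcard cardJg leqnn andbT -genJ gen_subG.
apply/subsetP => _ /imsetP[_ /setUP[] /imsetP[x Xx ->] ->].
  by rewrite ltransJ groupV rtrans_in.
by rewrite rtransJ groupV ltrans_in.
Qed.

End TranslationRelations.

(** * Climbing one commutative factor of a classical series *)

Section AbelianStep.

(** The quotient X/D enters through a map [phi] on Q, multiplicative on [X] with kernel [D] there,
    so that all permutations act on Q itself. *)
Variables (Q : finLoopType) (mQ : moufang Q) (X D : subloop Q) (V : loopType) (phi : Q -> V).
Hypotheses (sDX : D \subset X) (cgV : commutative_group V).
Hypothesis phiM : {in subloop_set X &, forall x y, phi (x * y) = phi x * phi y}.
Hypothesis phi_ker : forall x, x \in subloop_set X -> (phi x = 1 <-> x \in subloop_set D).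

Let M := translations_group (subloop_set X).
Let A := <<[set ltrans d | d in subloop_set D]>>%G.

Let XD d : d \in subloop_set D -> d \in subloop_set X. Proof. exact: (subsetP sDX). Qed.

(** Left and right translation by x both multiply [phi] by [phi x], since V is commutative; thus M
    acts on X/D by translations. *)
Let act_M m : m \in M ->
  exists t, forall x, x \in subloop_set X -> m x \in subloop_set X /\ phi (m x) = t * phi x.
Proof.
have [VA VC] := cgV.
move=> /gen_prodgP[n [c cS ->]]; elim/big_ind: _ => [|g h [t tP] [s sP]|i _].
- by exists 1 => x Xx; rewrite perm1 lmul1x.
- exists (s * t) => x Xx; have [Xg Eg] := tP x Xx; have [Xh Eh] := sP _ Xg.
  by rewrite permM Eh Eg VA.
- have /setUP[/imsetP[x Xx ->]|/imsetP[x Xx ->]] := cS i; exists (phi x) => y Xy.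
    by rewrite trans_E subloopM ?phiM.
  by rewrite trans_E subloopM ?phiM // VC.
Qed.

(** [phi] is trivial on [w], so w a(d) w has the same image as a(d), and the inverse of [a] brings
    it back into [D]. *)
Let kernel_conj a w d : a \in M -> w \in subloop_set D -> d \in subloop_set D ->
  exists2 d', d' \in subloop_set D & (w * a d) * w = a d'.
Proof.
move=> Ma Dw Dd; have [VA VC] := cgV.
have [t tP] := act_M Ma; have [Xad Ead] := tP d (XD Dd).
have Ma' : a^-1%g \in M by rewrite groupV.
have [s sP] := act_M Ma'.
have Xw := XD Dw; have Xwa : w * a d \in subloop_set X by apply: subloopM.
have Xb : (w * a d) * w \in subloop_set X by apply: subloopM.
have [Xd' _] := sP _ Xb.
exists (a^-1%g ((w * a d) * w)); last by rewrite permKV.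
apply/(phi_ker Xd'); have [_] := tP _ Xd'; rewrite permKV !phiM //.
have /(phi_ker Xw) -> := Dw; have /(phi_ker (XD Dd)) dd := Dd.
by rewrite Ead dd lmul1x !lmulx1 -{1}[t]lmulx1 => /lmulI.
Qed.

(** The autotopism gives L_x c = g L_a(x), products from left to right; in a quotient of two
    translations [c] cancels. *)
Let conj_ratio (c a g : {perm Q}) : (forall x y, c (x * y) = a x * g y) -> forall p q,
  ((ltrans p * (ltrans q)^-1) ^ g = ltrans (a p) * (ltrans (a q))^-1)%g.
Proof.
move=> E p q; have H x : (ltrans x * c = g * ltrans (a x))%g.
  by apply/permP => y; rewrite !permM !trans_E E.
have H' x : (ltrans x = g * ltrans (a x) * c^-1)%g by rewrite -H mulgK.
by rewrite (H' p) (H' q) conjgE !invMg invgK !mulgA !(mulgKV, mulVg, mul1g, mulgK).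
Qed.

(** By [conj_ratio], L_d ^ g = L_a(d) L_a(1)^-1. Conjugating by L_w^-1 and inserting L_w L_w^-1 in
    the middle gives, by Moufang, the quotient of the translations by w a(d) w and w a(1) w. By
    [kernel_conj] these are a(d') and a(e), so the result is (L_d' L_e^-1) ^ g. *)
Let A_norm g : g \in M -> A \subset 'N(A :^ g)%g.
Proof.
move=> Mg; have /autotopicP[a [c [Ma _ E]]] := subsetP (autotopic_translations _ mQ) _ Mg.
have Ad d : d \in subloop_set D -> ltrans d \in A by move=> Dd; rewrite mem_gen ?imset_f.
rewrite gen_subG; apply/subsetP => _ /imsetP[w Dw ->].
rewrite -groupV inE -!genJ gen_subG.
apply/subsetP => _ /imsetP[_ /imsetP[_ /imsetP[d Dd ->] ->] ->].
have [d' Dd' Ed'] := kernel_conj Ma Dw Dd.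
have [e De Ee] := kernel_conj Ma Dw (subloop1 D).
suff -> : ((ltrans d ^ g) ^ (ltrans w)^-1 = (ltrans d' * (ltrans e)^-1) ^ g)%g.
  have : (ltrans d' * (ltrans e)^-1)%g \in A by rewrite groupM ?groupV ?Ad.
  by rewrite /= genJ memJ_conjg.
rewrite -{1}[ltrans d]mulg1 -{1}(invg1 _) -(ltrans1 Q) !(conj_ratio E) -Ed' -Ee.
by rewrite -!ltrans_moufang // conjgE !invMg invgK !mulgA mulgK.
Qed.

Let KL := <<class_support A M>>%G.
Let KR := (KL :^ linv_perm mQ)%G.
Let K := (KL <*> KR)%G.

Let sA_M : A \subset M.
Proof. by rewrite gen_subG; apply/subsetP => _ /imsetP[d Dd ->]; rewrite ltrans_in ?XD. Qed.

Let nKL : (KL <| M)%g.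
Proof.
by rewrite /normal norms_gen ?class_support_norm // gen_subG class_support_subG.
Qed.

Let nKR : (KR <| M)%g.
Proof. by rewrite -[X in (_ <| X)%g](translationsJ mQ) normalJ. Qed.

Let nK : (K <| M)%g. Proof. exact: normalY. Qed.

Let solK : solvable A -> solvable K.
Proof.
move=> sA; have sKL : solvable KL by apply: solvable_class_support A_norm.
by apply: (solvable_joinG nKL); rewrite ?solvableJ ?(normal_sub nKR).
Qed.

Let ltransK d : d \in subloop_set D -> ltrans d \in K.
Proof.
move=> Dd; apply: (subsetP (joing_subl _ _)); rewrite mem_gen //.
by apply/imset2P; exists (ltrans d) 1%g; rewrite ?conjg1 ?group1 // mem_gen ?imset_f.
Qed.

Let rtransK d : d \in subloop_set D -> rtrans d \in K.
Proof.
move=> Dd; apply: (subsetP (joing_subr _ _)).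
rewrite -groupV -(ltransJ mQ) memJ_conjg mem_gen //.
by apply/imset2P; exists (ltrans d) 1%g; rewrite ?conjg1 ?group1 // mem_gen ?imset_f.
Qed.

Let nKM g : g \in M -> g \in 'N(K)%g. Proof. exact/subsetP/normal_norm/nK. Qed.

Let l (x : subloop_sort X) := coset_morphism K (ltrans (val x)).
Let r (x : subloop_sort X) := coset_morphism K (rtrans (val x)).

Let Ml (x : subloop_sort X) : ltrans (val x) \in M. Proof. exact/ltrans_in/valP. Qed.
Let Mr (x : subloop_sort X) : rtrans (val x) \in M. Proof. exact/rtrans_in/valP. Qed.

Let l_M x z : (l (z * x)%L = l x ^ r z * l z)%g.
Proof. by rewrite /l ltransM // morphM ?groupJ ?nKM // morphJ ?nKM. Qed.

Let r_M y z : (r (y * z)%L = r y ^ l z * r z)%g.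
Proof. by rewrite /r rtransM // morphM ?groupJ ?nKM // morphJ ?nKM. Qed.

Let phi_eq (x y : subloop_sort X) : phi (val x) = phi (val y) ->
  exists2 d : subloop_sort X, val d \in subloop_set D & x = d * y.
Proof.
move=> E; exists (rdiv x y); last by rewrite rdivK.
have Xx := valP x; have Xy := valP y; have Xd := valP (rdiv x y).
apply/(phi_ker Xd); apply: (@lmulIr _ (phi (val y))); rewrite lmul1x -[RHS]E -phiM //.
by rewrite /= rdivK.
Qed.

(** Translations by [D] die modulo [K], so [l], and likewise [r], depends only on the class in X/D.
    The commutative group laws of V thereby reach the hypotheses of [class_two_solvable]. *)
Let l_eq x y : phi (val x) = phi (val y) -> l x = l y.
Proof.
case/phi_eq=> d Dd ->; rewrite l_M; have -> : r d = 1%g by apply/coset_id/rtransK.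
by have -> : l d = 1%g by [apply/coset_id/ltransK]; rewrite conjg1 mulg1.
Qed.

Let r_eq x y : phi (val x) = phi (val y) -> r x = r y.
Proof.
case/phi_eq=> d Dd ->; rewrite r_M; have -> : r d = 1%g by apply/coset_id/rtransK.
by rewrite conj1g mul1g.
Qed.

Let phi_valM (x y : subloop_sort X) : phi (val (x * y)) = phi (val x) * phi (val y).
Proof. by rewrite /= phiM ?(valP x) ?(valP y). Qed.

Lemma solvable_translations_step : solvable A -> solvable M.
Proof.
move=> /solK sK; have [VA VC] := cgV; rewrite (series_sol nK) sK /=.
have lC x y : l (x * y) = l (y * x) by apply: l_eq; rewrite !phi_valM.
have rC x y : r (x * y) = r (y * x) by apply: r_eq; rewrite !phi_valM.
have lA x y z : l (x * (y * z)) = l (x * y * z) by apply: l_eq; rewrite !phi_valM VA.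
have rA x y z : r (x * (y * z)) = r (x * y * z) by apply: r_eq; rewrite !phi_valM VA.
have := class_two_solvable l_M r_M lC rC lA rA; apply: solvableS.
rewrite /= quotient_gen; last by rewrite (subset_trans (subset_gen _)) // (normal_norm nK).
rewrite gen_subG; apply/subsetP => _ /morphimP[g _ /setUP[] /imsetP[x Xx ->] ->].
  rewrite mem_gen // inE; apply/orP; left; apply/imsetP.
  by exists (exist _ x Xx : subloop_sort X).
rewrite mem_gen // inE; apply/orP; right; apply/imsetP.
by exists (exist _ x Xx : subloop_sort X).
Qed.

End AbelianStep.

(** * Solvability of Mlt(Q) from classical solvability *)

Section ClassicalSeries.

Variables (Q : finLoopType) (mQ : moufang Q).

Lemma solvable_translations_quotient (X D : subloop Q) (nD : normal_subloop (restrict X D)) :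
    D \subset X -> commutative_group (quotient_loop nD) ->
  solvable (translations D) -> solvable (translations X).
Proof.
move=> sDX cgV sD.
(* Points outside [X] get the class of 1 by default; the conditions on [phi] concern only [X]. *)
pose phi (u : Q) : quotient_loop nD := \pi_(quotient_loop nD) (insubd (1 : subloop_sort X) u).
have phiE (x : subloop_sort X) : phi (val x) = \pi_(quotient_loop nD) x by rewrite /phi valKd.
have lift (x : Q) : x \in subloop_set X -> exists x' : subloop_sort X, x = val x'.
  by move=> Xx; exists (exist _ x Xx).
apply: (solvable_translations_step mQ sDX cgV (phi := phi)).
- move=> _ _ /lift[x ->] /lift[y ->].
  by rewrite -[(val x * val y)%L]/(val (x * y)) !phiE (quotM nD x y).
- move=> _ /lift[x ->]; rewrite phiE; split => [/esym E|Dx].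
    have /(quot_eq nD 1 x) := E; rewrite (ldiv_eq (lmul1x x)).
    by rewrite inE.
  apply/esym/(quot_eq nD 1 x); rewrite (ldiv_eq (lmul1x x)).
  by rewrite inE.
apply: solvableS sD; rewrite gen_subG; apply/subsetP => _ /imsetP[d Dd ->].
exact: ltrans_in.
Qed.

Lemma classically_solvable_Mlt : classically_solvable Q -> solvable (Mlt Q).
Proof.
case=> n [S [S0 Sn Sstep]]; rewrite -translationsT -S0.
(* The index is reversed because the climb starts at the trivial end of the series. *)
suff H i : i <= n -> solvable (translations (S (n - i))).
  by have := H n (leqnn n); rewrite subnn.
elim: i => [_|i IHi lin].
  rewrite subn0 Sn; apply: solvableS (solvable1 _).
  rewrite gen_subG; apply/subsetP => _ /setUP[] /imsetP[x /set1P-> ->].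
    by rewrite ltrans1 inE.
  by rewrite rtrans1 inE.
have ltn : n - i.+1 < n by rewrite ltn_subrL /= (leq_trans _ lin).
have [sS [nS cS]] := Sstep _ ltn.
apply: (solvable_translations_quotient sS cS).
by rewrite -subSn // subSS; apply/IHi/ltnW.
Qed.

End ClassicalSeries.

(** * From abelian congruences to commutative group factors *)

Section CongruenceSeries.

Variable P : finLoopType.

(** Closure gives xX inside X, and equal cardinality makes this an equality. *)
Lemma coset_rel_one (X : {set P}) x :
  1 \in X -> {in X &, forall x y, x * y \in X} -> x \in X -> coset_rel X 1 x.
Proof.
move=> X1 XM Xx; rewrite /coset_rel eq_sym eqEcard; apply/andP; split.
  apply/subsetP => _ /imsetP[y Xy ->]; apply/imsetP; exists (x * y); rewrite ?lmul1x //.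
  exact: XM.
by rewrite !card_imset //; apply: lmulI.
Qed.

Variables (X : {set P}) (abX : induces_abelian_congruence X).
Hypotheses (X1 : 1 \in X) (XM : {in X &, forall x y, x * y \in X}).

Let rel1 x : x \in X -> coset_rel X 1 x. Proof. exact: coset_rel_one. Qed.

(* The term u \ (a u) takes the value 1 at a = 1 whatever u is. *)
Lemma abelian_congruence_comm x y : x \in X -> y \in X -> x * y = y * x.
Proof.
move=> Xx Xy.
pose v0 : 'I_2 := ord0; pose v1 : 'I_2 := lift ord0 ord0.
pose t : loop_term 2 := TLdiv (TVar v1) (TMul (TVar v0) (TVar v1)).
have := abX (t := t) (u := fun _ => 1) (v := fun _ => x) (rel1 Xy) (fun _ => rel1 Xx).
rewrite /= !env_cons0 !env_consS !lmul1x !lmulx1 !(ldiv_eq (lmul1x _)) !(ldiv_eq (lmulx1 _)).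
by move=> /(_ erefl) {1}->; rewrite lmulK.
Qed.

(* The term w \ (u (v a)) takes the value 1 at a = 1 whenever w = uv. *)
Lemma abelian_congruence_assoc x y z : x \in X -> y \in X -> z \in X ->
  x * (y * z) = (x * y) * z.
Proof.
move=> Xx Xy Xz.
pose v0 : 'I_4 := ord0; pose v1 : 'I_4 := lift ord0 ord0.
pose v2 : 'I_4 := lift ord0 (lift ord0 ord0).
pose v3 : 'I_4 := lift ord0 (lift ord0 (lift ord0 ord0)).
pose t : loop_term 4 := TLdiv (TVar v3) (TMul (TVar v1) (TMul (TVar v2) (TVar v0))).
pose e : 'I_3 -> P := env_cons x (env_cons y (fun _ : 'I_1 => x * y)).
have Xe i : coset_rel X 1 (e i).
  rewrite /e; case: (unliftP ord0 i) => [j|] ->; rewrite ?env_cons0 ?env_consS ?rel1 //.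
  by case: (unliftP ord0 j) => [k|] ->; rewrite ?env_cons0 ?env_consS ?rel1 ?XM.
have := abX (t := t) (u := fun _ => 1) (v := e) (rel1 Xz) Xe.
rewrite /= !env_cons0 !env_consS /e !env_consS !env_cons0 !lmul1x !lmulx1.
rewrite !(ldiv_eq (lmul1x _)) !(ldiv_eq (lmulx1 _)).
by move=> /(_ erefl) {2}->; rewrite lmulK.
Qed.

End CongruenceSeries.

Section RestrictNormal.

Variables (Q : finLoopType) (X : subloop Q).

(** Through this lift an inner mapping of [X] becomes the restriction of an inner mapping of Q, so
    normality passes to [X]. *)
Lemma Mlt_subloop_lift f : f \in Mlt (subloop_sort X) ->
  exists2 F, F \in Mlt Q & forall x : subloop_sort X, val (f x) = F (val x).
Proof.
case/gen_prodgP=> n [c cS ->]; elim/big_ind: _ => [|g h [G MG GE] [H MH HE]|i _].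
- by exists 1%g; rewrite ?group1 // => x; rewrite !perm1.
- by exists (G * H)%g; rewrite ?groupM // => x; rewrite !permM HE GE.
- have /setUP[/imsetP[u _ ->]|/imsetP[u _ ->]] := cS i.
    by exists (ltrans (val u)); rewrite ?ltrans_Mlt // => x; rewrite !trans_E.
  by exists (rtrans (val u)); rewrite ?rtrans_Mlt // => x; rewrite !trans_E.
Qed.

Lemma restrict_normal (Y : subloop Q) : normal_subloop Y -> normal_subloop (restrict X Y).
Proof.
move=> nY; apply/subsetP => f; rewrite inE => /andP[Mf /astab1P f1].
rewrite inE; apply/andP; split; rewrite inE //; apply/subsetP => x.
rewrite !inE /= apermE => Yx; have [F MF FE] := Mlt_subloop_lift Mf.
rewrite FE; apply: (normal_inn nY) => //.
by rewrite -[1]/(val (1 : subloop_sort X)) -FE; congr val; rewrite -[RHS]f1.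
Qed.

End RestrictNormal.

Lemma congruence_solvable_classically (Q : finLoopType) :
  congruence_solvable Q -> classically_solvable Q.
Proof.
case=> n [S [S0 Sn Sstep]]; exists n, S; split=> // i lin.
have [sS [nS abS]] := Sstep i lin; split=> //.
exists (restrict_normal (S i) nS).
pose QS := quotient_loop nS.
have X1 : 1 \in quotient_set nS (S i) by apply/imsetP; exists 1; rewrite ?subloop1.
have XM : {in quotient_set nS (S i) &, forall x y, x * y \in quotient_set nS (S i)}.
  by move=> _ _ /imsetP[x Sx ->] /imsetP[y Sy ->]; rewrite (quotM nS x y) imset_f ?subloopM.
have Xpi (x : subloop_sort (S i)) : \pi_QS (val x) \in quotient_set nS (S i).
  by rewrite imset_f ?(valP x).
(* Elements of [S i] congruent in the quotient of Q are congruent in the quotient of [S i], so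
   identities can be checked in the former. *)
have lift (x y : subloop_sort (S i)) : \pi_QS (val x) = \pi_QS (val y) ->
    \pi_(quotient_loop (restrict_normal (S i) nS)) x
    = \pi_(quotient_loop (restrict_normal (S i) nS)) y.
  by move=> /(quot_eq nS) E; apply/(quot_eq (restrict_normal (S i) nS)); rewrite inE.
have piM (x y : subloop_sort (S i)) : \pi_QS (val (x * y)%L) = (\pi_QS (val x) * \pi_QS (val y))%L.
  by rewrite -(quotM nS).
split.
  elim/quotW=> x; elim/quotW=> y; elim/quotW=> z.
  rewrite (quotM _ y z) (quotM _ x y) (quotM _ x) (quotM _ (x * y)); apply: lift.
  by rewrite !piM; apply: (abelian_congruence_assoc abS X1 XM).
elim/quotW=> x; elim/quotW=> y; rewrite (quotM _ x y) (quotM _ y x); apply: lift.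
by rewrite !piM; apply: (abelian_congruence_comm abS X1 XM).
Qed.

Theorem theorem5p7 (Q : finLoopType) (mQ : moufang Q) (dQ : three_divisible Q) :
  classically_solvable Q <-> congruence_solvable Q.
Proof.
split; last exact: congruence_solvable_classically.
by move=> /(classically_solvable_Mlt mQ)/(Mlt_solvable_congruence mQ).
Qed.
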